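(* Let $F>0$, let $N\ge3$ be an integer, $\varepsilon=1/N$, and let $y_F$ be the uniform circular configuration of $N$ atoms with nearest neighbor interatomic spacing $F\varepsilon$. Given $f\in\mathcal U$, let $u^{\mathrm a},u^{\mathrm{CB}}\in\mathcal U$ satisfy $$\delta\mathcal E^{\mathrm a}(y_F)[v]+\delta^2\mathcal E^{\mathrm a}(y_F)[u^{\mathrm a},v]=\langle f,v\rangle\quad\text{and}\quad\delta\mathcal E^{\mathrm{CB}}(y_F)[v]+\delta^2\mathcal E^{\mathrm{CB}}(y_F)[u^{\mathrm{CB}},v]=\langle f,v\rangle$$ for all $v\in\mathcal U$. If $\phi\in C^3(0,\infty)$ and $$\gamma_2:=\min\left\{\phi''(F)+4\,\phi''(2F),\ \frac{\phi'(F)+2\,\phi'(2F)}{F}\right\}>0,$$ then $$\|(u^{\mathrm a}-u^{\mathrm{CB}})'\|_{\ell^2_\varepsilon}\le\gamma_2^{-1}\left[C_\kappa\varepsilon^2+(C_1\varepsilon^2+C_2\varepsilon^4)\left(\|(u^{\mathrm a})'''\|_{\ell^2_\varepsilon}+\|(u^{\mathrm a})''\|_{\ell^2_\varepsilon}+\|(u^{\mathrm a})'\|_{\ell^2_\varepsilon}\right)\right],$$ where $$C_1=\max\left\{|\phi''(2F)|,\ \left|\frac{\phi'(2F)}{2F}\right|,\ 4\pi^2\left|\phi''(2F)-\frac{\phi'(2F)}{2F}\right|+12\,C_\phi\right\},\quad C_2=4\pi C_\phi,$$ $$C_\kappa=4\,C_\phi(1+\pi^2\varepsilon^2)F+2\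pi^2|\phi'(2F)|.$$
   Context: Let $\varepsilon=1/N$. $\mathcal Y$ is the set of sequences $y=\{y_\ell\}_{\ell\in\mathbb Z}$, $y_\ell\in\mathbb R^2$, with $y_{\ell+N}=y_\ell+(y_N-y_0)$ for all $\ell$. $\mathcal U$ is the set of $N$-periodic sequences $u$ in $\mathbb R^2$ with $\sum_{\ell=1}^N u_\ell=0$. Backward differences: $y'_\ell=(y_\ell-y_{\ell-1})/\varepsilon$, $y^{(n)}_\ell=(y^{(n-1)}_\ell-y^{(n-1)}_{\ell-1})/\varepsilon$. $\|\cdot\|$ is the Euclidean norm; $\langle v,w\rangle=\varepsilon\sum_{\ell=1}^N v_\ell\cdot w_\ell$, $\|v\|_{\ell^2_\varepsilon}=\langle v,v\rangle^{1/2}$. $\phi:(0,\infty)\to\mathbb R$ is the pair potential. $\mathcal E^{\mathrm a}(y)=\varepsilon\sum_{\ell=1}^N[\phi(\|y'_\ell\|)+\phi(\|y'_{\ell+1}+y'_\ell\|)]$; $\mathcal E^{\mathrm{CB}}(y)=\varepsilon\sum_{\ell=1}^N[\phi(\|y'_\ell\|)+\phi(2\|y'_\ell\|)]$. First and second variations: $\delta\mathcal E(y)[u]=\frac{d}{dt}\mathcal E(y+tu)|_{t=0}$, $\delta^2\mathcal E(y)[u,v]=\frac{\partial^2}{\partial s\partial t}\mathcal E(y+su+tv)|_{s=t=0}$. The uniform circular configuration is $(y_F)_\ell=R(\cos(2\pi\varepsilon\ell),\sin(2\pi\varepsilon\ell))$ with $F\varepsilon=2R\sin(\pi\varepsilon)$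 (up to rigid motions). With $F_2=F\cos(\pi\varepsilon)$, $C_\phi>0$ denotes a constant, independent of $\varepsilon$, such that $\max\left\{|\phi''(2F_2)-\phi''(2F)|,\ \left|\frac{\phi'(2F_2)}{2F_2}-\frac{\phi'(2F)}{2F}\right|\right\}\le C_\phi\varepsilon^2$. *)

(* Defs.v *)
From Stdlib Require Export Reals ZArith.
From Coquelicot Require Export Coquelicot.

Open Scope R_scope.

(* Coquelicot's [norm] on [R * R] is the Euclidean norm (see [prod_norm]). *)
Notation vec := (R * R)%type.

Definition dot (v w : vec) : R := fst v * fst w + snd v * snd w.

Definition eps (N : nat) : R := / INR N.

Definition psum {G : AbelianMonoid} (N : nat) (v : Z -> G) : G :=
  sum_n_m (fun l => v (Z.of_nat l)) 1 N.

Definition in_U (N : nat) (u : Z -> vec) : Prop :=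
  (forall l : Z, u (l + Z.of_nat N)%Z = u l) /\ psum N u = zero.

Definition bdiff (N : nat) (y : Z -> vec) : Z -> vec :=
  fun l => scal (/ eps N) (minus (y l) (y (l - 1)%Z)).

Fixpoint bdiff_n (N n : nat) (y : Z -> vec) : Z -> vec :=
  match n with
  | O => y
  | S m => bdiff N (bdiff_n N m y)
  end.

Definition ip (N : nat) (v w : Z -> vec) : R :=
  eps N * psum N (fun l => dot (v l) (w l)).

Definition l2norm (N : nat) (v : Z -> vec) : R := sqrt (ip N v v).

Definition Ea (phi : R -> R) (N : nat) (y : Z -> vec) : R :=
  eps N * psum N (fun l =>
    phi (norm (bdiff N y l))
    + phi (norm (plus (bdiff N y (l + 1)%Z) (bdiff N y l)))).

Definition ECB (phi : R -> R) (N : nat) (y : Z -> vec) : R :=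
  eps N * psum N (fun l =>
    phi (norm (bdiff N y l)) + phi (2 * norm (bdiff N y l))).

Definition perturb (y : Z -> vec) (t : R) (u : Z -> vec) : Z -> vec :=
  fun l => plus (y l) (scal t (u l)).

Definition var1 (E : (Z -> vec) -> R) (y u : Z -> vec) : R :=
  Derive (fun t => E (perturb y t u)) 0.

Definition var2 (E : (Z -> vec) -> R) (y u v : Z -> vec) : R :=
  Derive (fun s => Derive (fun t => E (perturb (perturb y s u) t v)) 0) 0.

Definition circle (N : nat) (Rad : R) : Z -> vec :=
  fun l => (Rad * cos (2 * PI * eps N * IZR l),
            Rad * sin (2 * PI * eps N * IZR l)).

Definition rigid_motion (g : vec -> vec) : Prop :=
  forall p q : vec, norm (minus (g p) (g q)) = norm (minus p q).

(* The radius is the one for which neighbouring atoms are at distance F * eps;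
   the circle is only fixed up to a rigid motion of the plane. *)
Definition uniform_circular (F : R) (N : nat) (y : Z -> vec) : Prop :=
  exists (Rad : R) (g : vec -> vec),
    F * eps N = 2 * Rad * sin (PI * eps N) /\
    rigid_motion g /\
    forall l : Z, y l = g (circle N Rad l).

(* phi is a total function of which only the values on (0, +oo) matter. *)
Definition C3_pos (phi : R -> R) : Prop :=
  forall (k : nat) (r : R), (k <= 3)%nat -> 0 < r ->
    ex_derive_n phi k r /\ continuous (Derive_n phi k) r.

Definition dphi (phi : R -> R) : R -> R := Derive phi.
Definition ddphi (phi : R -> R) : R -> R := Derive_n phi 2.

Definition F2 (F : R) (N : nat) : R := F * cos (PI * eps N).

(* C is chosen before N, i.e. it does not depend on eps = 1/N. *)
Definition is_Cphi (phi : R -> R) (F C : R) : Prop :=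
  0 < C /\
  forall N : nat, (3 <= N)%nat ->
    Rmax (Rabs (ddphi phi (2 * F2 F N) - ddphi phi (2 * F)))
         (Rabs (dphi phi (2 * F2 F N) / (2 * F2 F N)
                - dphi phi (2 * F) / (2 * F)))
    <= C * eps N ^ 2.

Definition gamma2 (phi : R -> R) (F : R) : R :=
  Rmin (ddphi phi F + 4 * ddphi phi (2 * F))
       ((dphi phi F + 2 * dphi phi (2 * F)) / F).

Definition C1 (phi : R -> R) (F Cphi : R) : R :=
  Rmax (Rabs (ddphi phi (2 * F)))
    (Rmax (Rabs (dphi phi (2 * F) / (2 * F)))
       (4 * PI ^ 2 * Rabs (ddphi phi (2 * F) - dphi phi (2 * F) / (2 * F))
        + 12 * Cphi)).

Definition C2 (Cphi : R) : R := 4 * PI * Cphi.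

Definition Ckappa (phi : R -> R) (F Cphi : R) (N : nat) : R :=
  4 * Cphi * (1 + PI ^ 2 * eps N ^ 2) * F + 2 * PI ^ 2 * Rabs (dphi phi (2 * F)).

(* Main.v *)
Require Import Defs.
From Stdlib Require Import Lra Lia.

(* The second variation of the Cauchy-Born energy at y_F is diagonal in the frame
   (t_l, perp t_l) of unit bond vectors and is coercive with constant gamma2.
   Testing both equilibrium equations with e = u^a - u^CB bounds gamma2 |e'|^2 by
   the differences of the first variations at e and of the second variations at
   (u^a, e).  The second-neighbour bonds point along w_l, which is t_l rotated by
   the angle pi eps, while w_{l-1} is t_l rotated by - pi eps.  After a summation
   by parts onto e'_l the first-order terms in the two rotations cancel, up to a
   term of order eps multiplied by the central difference of (u^a)', which itself
   is of order eps; hence every remainder has size eps^2. *)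

(** The Hessian of [p -> phi(|p|)] at a bond of length [r] and direction [t] is [phi''(r)] along [t]
    and [phi'(r)/r] along [perp t]; this is why the quotients [phi'(r)/r] stand beside [phi''(r)] in
    [gamma2], [C1] and [is_Cphi]. Two effects make the energies differ. The sum of two neighbouring
    bonds has length [2 * F2], not [2 * F], so the atomistic coefficients are evaluated at another
    point; [Cphi] pays for exactly this. With the coefficients frozen at [2 * F] the remaining error
    is geometric: turning the frame matters only as far as the form is anisotropic, hence the factor
    [|phi''(2F) - phi'(2F)/(2F)|]. Coercivity is taken from the Cauchy-Born form because it is
    local, so that it can be read off bond by bond; the residual is then evaluated at the atomistic
    solution, whose differences appear on the right. A technical obstacle is that [phi] is
    controlled on positive lengths only, while [var2] differentiates a derivative: the inner
    derivative has to be known for all [s] near 0, not just at 0. *)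

(** * Sums over one period and their derivatives *)

Lemma psum_ext (N : nat) (v w : Z -> R) :
  (forall l, v l = w l) -> psum N v = psum N w.
Proof. intros H; apply sum_n_m_ext; intros n; apply H. Qed.

Lemma psum_plus (N : nat) (v w : Z -> R) :
  psum N (fun l => v l + w l) = psum N v + psum N w.
Proof. exact (sum_n_m_plus (fun n => v (Z.of_nat n)) (fun n => w (Z.of_nat n)) 1 N). Qed.

Lemma psum_scal (N : nat) (c : R) (v : Z -> R) :
  psum N (fun l => c * v l) = c * psum N v.
Proof. exact (sum_n_m_mult_l (K := R_Ring) c (fun n => v (Z.of_nat n)) 1 N). Qed.

Lemma psum_le (N : nat) (v w : Z -> R) :
  (forall l, v l <= w l) -> psum N v <= psum N w.
Proof. intros H; apply sum_n_m_le; intros n; apply H. Qed.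

Lemma psum_nonneg (N : nat) (v : Z -> R) :
  (forall l, 0 <= v l) -> 0 <= psum N v.
Proof.
  intros H.
  replace 0 with (psum N (fun l => 0 * v l)) by (rewrite psum_scal; apply Rmult_0_l).
  apply psum_le; intros l; rewrite Rmult_0_l; apply H.
Qed.

Lemma psum_S {G : AbelianMonoid} (N : nat) (v : Z -> G) :
  psum (S N) v = plus (psum N v) (v (Z.of_nat (S N))).
Proof. unfold psum; rewrite sum_n_Sm by lia; reflexivity. Qed.

(** Over [1..n] the two sums differ only in their end terms [v 1] and [v (1 + n)], which is provable
    by induction on [n] without periodicity; at [n = N] the end terms agree. *)
Lemma psum_shift (N : nat) (v : Z -> R) :
  (forall l, v (l + Z.of_nat N)%Z = v l) ->
  psum N (fun l => v (l + 1)%Z) = psum N v.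
Proof.
  intros per.
  assert (H : forall n, psum n (fun l => v (l + 1)%Z) + v 1%Z
                        = psum n v + v (1 + Z.of_nat n)%Z).
  { induction n as [|n IH].
    - unfold psum; rewrite !sum_n_m_zero by lia; reflexivity.
    - rewrite !psum_S; change plus with Rplus.
      rewrite !Nat2Z.inj_succ; unfold Z.succ.
      replace (1 + (Z.of_nat n + 1))%Z with (Z.of_nat n + 1 + 1)%Z by ring.
      replace (1 + Z.of_nat n)%Z with (Z.of_nat n + 1)%Z in IH by ring.
      lra. }
  specialize (H N); rewrite per in H; lra.
Qed.

Lemma psum_Cauchy_Schwarz (N : nat) (v w : Z -> R) :
  (psum N (fun l => v l * w l)) ^ 2
  <= psum N (fun l => v l ^ 2) * psum N (fun l => w l ^ 2).
Proof.
  set (p := psum N (fun l => v l * w l)).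
  set (a := psum N (fun l => v l ^ 2)).
  set (b := psum N (fun l => w l ^ 2)).
  assert (H : forall c d, 0 <= c ^ 2 * a + 2 * c * d * p + d ^ 2 * b).
  { intros c d; unfold p, a, b.
    rewrite <- !psum_scal, <- !psum_plus.
    apply psum_nonneg; intros l.
    replace (c ^ 2 * v l ^ 2 + 2 * c * d * (v l * w l) + d ^ 2 * w l ^ 2)
      with ((c * v l + d * w l) ^ 2) by ring.
    apply pow2_ge_0. }
  pose proof (H 1 0) as Ha; pose proof (H 0 1) as Hb.
  destruct (Rle_lt_or_eq_dec 0 b ltac:(lra)) as [Hb'|Hb'].
  - pose proof (H b (- p)) as Hc.
    (* The choice [c = b], [d = - p] turns [H] into [0 <= b * (a * b - p ^ 2)]. *)
    apply Rmult_le_reg_l with b; [exact Hb'|]; nra.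
  (* With [b = 0] this choice gives [0 <= - (a + 2) * p ^ 2], which forces [p = 0]. *)
  - pose proof (H p (- (a + 1))) as Hc; pose proof (pow2_ge_0 p).
    rewrite <- Hb' in Hc; rewrite <- Hb'. nra.
Qed.

Lemma psum_is_derive (N : nat) (g : Z -> R -> R) (g' : Z -> R) (x : R) :
  (forall l, is_derive (g l) x (g' l)) ->
  is_derive (fun t : R => psum N (fun l => g l t)) x (psum N g').
Proof.
  intros H; induction N as [|N IH].
  - apply is_derive_ext with (fun _ => 0).
    + intros t; unfold psum; now rewrite sum_n_m_zero by lia.
    + unfold psum; rewrite sum_n_m_zero by lia.
      apply (is_derive_const (K := R_AbsRing) (V := R_NormedModule)).
  - rewrite psum_S.
    apply is_derive_ext with
      (fun t : R => plus (psum N (fun l => g l t)) (g (Z.of_nat (S N)) t)).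
    + intros t; now rewrite psum_S.
    + apply (is_derive_plus (K := R_AbsRing) (V := R_NormedModule));
        [exact IH | apply H].
Qed.

(** The neighbourhood of [s0] may depend on the index; finitely many of them intersect in a
    neighbourhood, built up by induction on [N]. *)
Lemma psum_locally_is_derive (N : nat) (g : Z -> R -> R -> R) (g' : Z -> R -> R)
    (s0 x : R) :
  (forall l, locally s0 (fun s : R => is_derive (g l s) x (g' l s))) ->
  locally s0 (fun s : R =>
    is_derive (fun t : R => psum N (fun l => g l s t)) x (psum N (fun l => g' l s))).
Proof.
  intros H; induction N as [|N IH].
  - apply filter_forall; intros s.
    apply is_derive_ext with (fun _ => 0).
    + intros t; unfold psum; now rewrite sum_n_m_zero by lia.
    + unfold psum; rewrite sum_n_m_zero by lia.
      apply (is_derive_const (K := R_AbsRing) (V := R_NormedModule)).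
  - generalize (filter_and _ _ IH (H (Z.of_nat (S N)))).
    apply filter_imp; intros s [H1 H2].
    rewrite psum_S.
    apply is_derive_ext with
      (fun t : R => plus (psum N (fun l => g l s t)) (g (Z.of_nat (S N)) s t)).
    + intros t; now rewrite psum_S.
    + now apply (is_derive_plus (K := R_AbsRing) (V := R_NormedModule)).
Qed.

(** * Derivatives of the energy of a single bond *)

Lemma norm_dot (p : vec) : norm p = sqrt (dot p p).
Proof.
  destruct p as [x y].
  change (norm (x, y)) with (sqrt (Rabs x ^ 2 + Rabs y ^ 2)).
  rewrite !pow2_abs; unfold dot; simpl; f_equal; ring.
Qed.

Definition perp (v : vec) : vec := (- snd v, fst v).

(** With [h = psi''(r)] and [k = psi'(r)/r] this is the Hessian of [p -> psi(|p|)] at [p = r t],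
    written in the orthonormal frame [t], [perp t]. *)
Definition frame_form (h k : R) (t x y : vec) : R :=
  h * (dot t x * dot t y) + k * (dot (perp t) x * dot (perp t) y).

Lemma is_derive_norm_line (p a : vec) (s : R) :
  0 < dot (plus p (scal s a)) (plus p (scal s a)) ->
  is_derive (fun s : R => norm (plus p (scal s a))) s
    (dot (plus p (scal s a)) a / norm (plus p (scal s a))).
Proof.
  intros H.
  apply is_derive_ext with
    (fun s : R => sqrt (dot (plus p (scal s a)) (plus p (scal s a)))).
  { intros t; now rewrite norm_dot. }
  rewrite norm_dot.
  pose proof (sqrt_lt_R0 _ H) as Hs.
  revert H Hs; destruct p as [p1 p2], a as [a1 a2].
  unfold dot; cbn; unfold mult; cbn; intros H Hs.
  auto_derive; [exact H|]. field. lra.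
Qed.

(** Keeps a perturbed bond away from zero length, where neither the norm nor the potential need be
    differentiable. *)
Lemma locally_line_nonzero (p a : vec) :
  0 < dot p p ->
  locally 0 (fun s : R => 0 < dot (plus p (scal s a)) (plus p (scal s a))).
Proof.
  intros H.
  assert (C : continuous (fun s : R => dot (plus p (scal s a)) (plus p (scal s a))) 0).
  { apply (ex_derive_continuous (K := R_AbsRing) (V := R_NormedModule)).
    destruct p as [p1 p2], a as [a1 a2]; unfold dot; cbn; unfold mult; cbn.
    auto_derive; exact I. }
  apply C, open_gt.
  destruct p as [p1 p2], a as [a1 a2]; revert H.
  unfold dot; cbn; unfold mult; cbn; intros H.
  now rewrite !Rmult_0_l, !Rplus_0_r.
Qed.

Lemma plus_scal_0 (p a : vec) : plus p (scal 0 a) = p.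
Proof.
  apply injective_projections; cbn; unfold mult; cbn; ring.
Qed.

Lemma norm_scal_unit (r : R) (t : vec) :
  0 < r -> dot t t = 1 -> norm (scal r t) = r.
Proof.
  intros Hr Ht; rewrite norm_dot.
  replace (dot (scal r t) (scal r t)) with (r * r * dot t t)
    by (destruct t; unfold dot; cbn; unfold mult; cbn; ring).
  rewrite Ht, Rmult_1_r; apply sqrt_square; lra.
Qed.

Lemma dot_scal_unit (r : R) (t : vec) :
  0 < r -> dot t t = 1 -> 0 < dot (scal r t) (scal r t).
Proof.
  intros Hr Ht.
  replace (dot (scal r t) (scal r t)) with (r * r * dot t t)
    by (destruct t; unfold dot; cbn; unfold mult; cbn; ring).
  rewrite Ht; nra.
Qed.

Section Bond.
Variables psi psi1 psi2 : R -> R.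
Hypothesis Hpsi1 : forall r, 0 < r -> is_derive psi r (psi1 r).
Hypothesis Hpsi2 : forall r, 0 < r -> is_derive psi1 r (psi2 r).

Lemma is_derive_bond (p b : vec) :
  0 < dot p p ->
  is_derive (fun t : R => psi (norm (plus p (scal t b)))) 0
    (psi1 (norm p) * (dot p b / norm p)).
Proof.
  intros H.
  assert (Hn : 0 < norm p) by (rewrite norm_dot; now apply sqrt_lt_R0).
  rewrite Rmult_comm.
  apply (is_derive_comp (K := R_AbsRing) (V := R_NormedModule) psi
           (fun t : R => norm (plus p (scal t b))) 0).
  - rewrite plus_scal_0; now apply Hpsi1.
  - pose proof (is_derive_norm_line p b 0) as D; rewrite !plus_scal_0 in D.
    now apply D.
Qed.

Lemma locally_is_derive_bond (p a b : vec) :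
  0 < dot p p ->
  locally 0 (fun s : R =>
    is_derive (fun t : R => psi (norm (plus (plus p (scal s a)) (scal t b)))) 0
      (psi1 (norm (plus p (scal s a)))
       * (dot (plus p (scal s a)) b / norm (plus p (scal s a))))).
Proof.
  intros H; generalize (locally_line_nonzero p a H).
  apply filter_imp; intros s Hs; now apply is_derive_bond.
Qed.

Lemma is_derive_bond_slope (r : R) (u a b : vec) :
  0 < r -> dot u u = 1 ->
  is_derive (fun s : R => psi1 (norm (plus (scal r u) (scal s a)))
      * (dot (plus (scal r u) (scal s a)) b / norm (plus (scal r u) (scal s a)))) 0
    (frame_form (psi2 r) (psi1 r / r) u a b).
Proof.
  intros Hr Hu.
  set (n := fun s => norm (plus (scal r u) (scal s a))).
  set (d := fun s => dot (plus (scal r u) (scal s a)) b).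
  assert (n0 : n 0 = r) by (unfold n; now rewrite plus_scal_0, norm_scal_unit).
  assert (Dn : is_derive n 0 (dot u a)).
  { pose proof (is_derive_norm_line (scal r u) a 0) as D.
    rewrite !plus_scal_0, norm_scal_unit in D by assumption.
    replace (dot u a) with (dot (scal r u) a / r); [apply D; now apply dot_scal_unit|].
    destruct u, a; unfold dot; cbn; unfold mult; cbn; field; lra. }
  assert (Dd : is_derive d 0 (dot a b)).
  { unfold d; destruct u, a, b; unfold dot; cbn; unfold mult; cbn.
    auto_derive; [exact I | ring]. }
  assert (d0 : d 0 = r * dot u b).
  { unfold d; rewrite plus_scal_0; destruct u, b; unfold dot; cbn; unfold mult; cbn; ring. }
  assert (D1 : is_derive (fun s : R => psi1 (n s)) 0 (dot u a * psi2 r)).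
  { apply (is_derive_comp (K := R_AbsRing) (V := R_NormedModule) psi1 n 0 (psi2 r) (dot u a)).
    - rewrite n0; now apply Hpsi2.
    - exact Dn. }
  assert (D2 : is_derive (fun s : R => d s / n s) 0
                 ((dot a b * n 0 - d 0 * dot u a) / n 0 ^ 2)).
  { apply is_derive_div; [exact Dd | exact Dn | lra]. }
  change (is_derive (fun s : R => psi1 (n s) * (d s / n s)) 0
            (frame_form (psi2 r) (psi1 r / r) u a b)).
  replace (frame_form (psi2 r) (psi1 r / r) u a b)
    with (dot u a * psi2 r * (d 0 / n 0)
          + psi1 (n 0) * ((dot a b * n 0 - d 0 * dot u a) / n 0 ^ 2)).
  - apply (is_derive_mult (K := R_AbsRing) (fun s : R => psi1 (n s))
             (fun s : R => d s / n s));
      [exact D1 | exact D2 | intros; apply Rmult_comm].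
  - rewrite n0, d0.
    (* The quotient rule yields [a.b - (u.a)(u.b)] with weight [psi1 r / r]; expanding [a.b] in the
       frame of [u] leaves only the [perp u] components there. *)
    replace (dot a b) with (dot u a * dot u b + dot (perp u) a * dot (perp u) b).
    + unfold frame_form; field; lra.
    + transitivity (dot u u * dot a b); [|rewrite Hu; ring].
      destruct u, a, b; unfold dot, perp; cbn; ring.
Qed.
End Bond.

(** * Variations of an energy built from two families of bonds *)

Section Energy.
Variables psi psi1 psi2 chi chi1 chi2 : R -> R.
Hypothesis Hpsi1 : forall r, 0 < r -> is_derive psi r (psi1 r).
Hypothesis Hpsi2 : forall r, 0 < r -> is_derive psi1 r (psi2 r).
Hypothesis Hchi1 : forall r, 0 < r -> is_derive chi r (chi1 r).
Hypothesis Hchi2 : forall r, 0 < r -> is_derive chi1 r (chi2 r).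
Variables (N : nat) (al be : (Z -> vec) -> Z -> vec).
Hypothesis Hal : forall y t u l, al (perturb y t u) l = plus (al y l) (scal t (al u l)).
Hypothesis Hbe : forall y t u l, be (perturb y t u) l = plus (be y l) (scal t (be u l)).
Variables (y t w : Z -> vec) (r q : R).
Hypotheses (Hr : 0 < r) (Hq : 0 < q).
Hypotheses (Ht : forall l, dot (t l) (t l) = 1) (Hw : forall l, dot (w l) (w l) = 1).
Hypotheses (Hyt : forall l, al y l = scal r (t l)) (Hyw : forall l, be y l = scal q (w l)).

(** Common shape of both energies, so that the calculus is done once. For [Ea], [be] adds two
    consecutive differences and [chi] is [phi]; for [ECB], [be] equals [al] and [chi] is [phi] of
    the doubled length. *)
Let E (z : Z -> vec) : R :=
  eps N * psum N (fun l => psi (norm (al z l)) + chi (norm (be z l))).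

Lemma var1_energy (v : Z -> vec) :
  var1 E y v = eps N * psum N (fun l =>
    psi1 r * dot (t l) (al v l) + chi1 q * dot (w l) (be v l)).
Proof.
  unfold var1, E; apply is_derive_unique.
  apply (is_derive_scal (fun s : R => psum N (fun l => psi (norm (al (perturb y s v) l))
           + chi (norm (be (perturb y s v) l))))).
  apply (psum_is_derive N (fun l s => psi (norm (al (perturb y s v) l))
           + chi (norm (be (perturb y s v) l)))); intros l.
  apply is_derive_ext with (fun s : R => plus (psi (norm (plus (scal r (t l)) (scal s (al v l)))))
           (chi (norm (plus (scal q (w l)) (scal s (be v l)))))).
  { intros s; now rewrite Hal, Hbe, Hyt, Hyw. }
  apply (is_derive_plus (K := R_AbsRing) (V := R_NormedModule)).
  - replace (psi1 r * dot (t l) (al v l)) with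
      (psi1 (norm (scal r (t l))) * (dot (scal r (t l)) (al v l) / norm (scal r (t l)))).
    + apply (is_derive_bond psi psi1 Hpsi1); now apply dot_scal_unit.
    + rewrite norm_scal_unit by auto.
      destruct (t l), (al v l); unfold dot; cbn; unfold mult; cbn; field; lra.
  - replace (chi1 q * dot (w l) (be v l)) with
      (chi1 (norm (scal q (w l))) * (dot (scal q (w l)) (be v l) / norm (scal q (w l)))).
    + apply (is_derive_bond chi chi1 Hchi1); now apply dot_scal_unit.
    + rewrite norm_scal_unit by auto.
      destruct (w l), (be v l); unfold dot; cbn; unfold mult; cbn; field; lra.
Qed.

Lemma var2_energy (u v : Z -> vec) :
  var2 E y u v = eps N * psum N (fun l =>
    frame_form (psi2 r) (psi1 r / r) (t l) (al u l) (al v l)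
    + frame_form (chi2 q) (chi1 q / q) (w l) (be u l) (be v l)).
Proof.
  unfold var2.
  set (slope := fun (k : R -> R) (p a b : vec) (s : R) => k (norm (plus p (scal s a)))
      * (dot (plus p (scal s a)) b / norm (plus p (scal s a)))).
  (* The inner derivative has this closed form only near [s = 0]: for larger [s] a perturbed bond
     may collapse. *)
  rewrite (Derive_ext_loc _ (fun s : R => eps N * psum N (fun l =>
    slope psi1 (scal r (t l)) (al u l) (al v l) s
    + slope chi1 (scal q (w l)) (be u l) (be v l) s))).
  - apply is_derive_unique.
    apply (is_derive_scal (fun s : R => psum N (fun l =>
      slope psi1 (scal r (t l)) (al u l) (al v l) s
      + slope chi1 (scal q (w l)) (be u l) (be v l) s))).
    apply (psum_is_derive N (fun l s =>
      slope psi1 (scal r (t l)) (al u l) (al v l) s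
      + slope chi1 (scal q (w l)) (be u l) (be v l) s)); intros l.
    apply (is_derive_plus (K := R_AbsRing) (V := R_NormedModule)).
    + now apply is_derive_bond_slope.
    + now apply is_derive_bond_slope.
  - assert (L : locally 0 (fun s : R => is_derive (fun z : R => psum N (fun l =>
        psi (norm (plus (plus (scal r (t l)) (scal s (al u l))) (scal z (al v l))))
        + chi (norm (plus (plus (scal q (w l)) (scal s (be u l))) (scal z (be v l)))))) 0
        (psum N (fun l =>
    slope psi1 (scal r (t l)) (al u l) (al v l) s
    + slope chi1 (scal q (w l)) (be u l) (be v l) s)))).
    { apply (psum_locally_is_derive N (fun l s z =>
        psi (norm (plus (plus (scal r (t l)) (scal s (al u l))) (scal z (al v l))))
        + chi (norm (plus (plus (scal q (w l)) (scal s (be u l))) (scal z (be v l)))))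
        (fun l s => slope psi1 (scal r (t l)) (al u l) (al v l) s
          + slope chi1 (scal q (w l)) (be u l) (be v l) s)).
      intros l.
      generalize (filter_and _ _
        (locally_is_derive_bond psi psi1 Hpsi1 (scal r (t l)) (al u l) (al v l)
           (dot_scal_unit _ _ Hr (Ht l)))
        (locally_is_derive_bond chi chi1 Hchi1 (scal q (w l)) (be u l) (be v l)
           (dot_scal_unit _ _ Hq (Hw l)))).
      apply filter_imp; intros s [H1 H2].
      now apply (is_derive_plus (K := R_AbsRing) (V := R_NormedModule)). }
    revert L; apply filter_imp; intros s Hs.
    apply is_derive_unique; unfold E.
    apply (is_derive_scal (fun z : R => psum N (fun l =>
       psi (norm (al (perturb (perturb y s u) z v) l))
       + chi (norm (be (perturb (perturb y s u) z v) l))))).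
    eapply is_derive_ext; [|exact Hs].
    intros z; apply psum_ext; intros l; cbv beta.
    now rewrite !Hal, !Hbe, Hyt, Hyw.
Qed.
End Energy.

(** * Rigid motions and the bond frames of the circle *)

Lemma norm_sqr (p : vec) : norm p ^ 2 = dot p p.
Proof.
  rewrite norm_dot; apply pow2_sqrt; destruct p; unfold dot; cbn; nra.
Qed.

(** Distances to the three points [(0,0)], [(1,0)], [(0,1)] determine [g p]. The images of the two
    unit vectors are orthonormal, and [sg] is their determinant: 1 for a rotation, -1 for a
    reflection. *)
Lemma rigid_motion_linear (g : vec -> vec) :
  rigid_motion g ->
  exists a b sg : R, a ^ 2 + b ^ 2 = 1 /\ sg ^ 2 = 1 /\
    forall p q : vec, minus (g p) (g q) =
      (a * (fst p - fst q) - sg * b * (snd p - snd q),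
       b * (fst p - fst q) + sg * a * (snd p - snd q)).
Proof.
  intros Hg.
  assert (D : forall p q, (fst (g p) - fst (g q)) ^ 2 + (snd (g p) - snd (g q)) ^ 2
                = (fst p - fst q) ^ 2 + (snd p - snd q) ^ 2).
  { intros p q; pose proof (Hg p q) as H.
    apply (f_equal (fun x => x ^ 2)) in H; rewrite !norm_sqr in H.
    unfold dot in H; cbn in H; cbn; nra. }
  set (a := fst (g (1, 0)) - fst (g (0, 0))).
  set (b := snd (g (1, 0)) - snd (g (0, 0))).
  set (c := fst (g (0, 1)) - fst (g (0, 0))).
  set (d := snd (g (0, 1)) - snd (g (0, 0))).
  pose proof (D (1, 0) (0, 0)) as Hab.
  pose proof (D (0, 1) (0, 0)) as Hcd.
  pose proof (D (1, 0) (0, 1)) as Hac.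
  cbn [fst snd] in Hab, Hcd, Hac.
  fold a b in Hab; fold c d in Hcd.
  assert (Ho : a * c + b * d = 0).
  { replace (fst (g (1, 0)) - fst (g (0, 1))) with (a - c) in Hac by (unfold a, c; ring).
    replace (snd (g (1, 0)) - snd (g (0, 1))) with (b - d) in Hac by (unfold b, d; ring).
    lra. }
  assert (Hab1 : a ^ 2 + b ^ 2 = 1) by lra.
  assert (Hc : c = - (a * d - b * c) * b).
  { transitivity (c * (a ^ 2 + b ^ 2) - a * (a * c + b * d));
      [rewrite Hab1, Ho; ring | ring]. }
  assert (Hd : d = (a * d - b * c) * a).
  { transitivity (d * (a ^ 2 + b ^ 2) - b * (a * c + b * d));
      [rewrite Hab1, Ho; ring | ring]. }
  assert (Hsg : (a * d - b * c) ^ 2 = 1).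
  { transitivity ((a ^ 2 + b ^ 2) * (c ^ 2 + d ^ 2) - (a * c + b * d) ^ 2);
      [ring | rewrite Ho, Hab1; lra]. }
  set (sg := a * d - b * c) in *.
  assert (L : forall p, fst (g p) - fst (g (0, 0)) = a * fst p + c * snd p /\
                        snd (g p) - snd (g (0, 0)) = b * fst p + d * snd p).
  { intros p.
    pose proof (D p (0, 0)) as H0.
    pose proof (D p (1, 0)) as H1.
    pose proof (D p (0, 1)) as H2.
    cbn [fst snd] in H0, H1, H2.
    set (X := fst (g p) - fst (g (0, 0))) in *.
    set (Y := snd (g p) - snd (g (0, 0))) in *.
    replace (fst (g p) - fst (g (1, 0))) with (X - a) in H1 by (unfold X, a; ring).
    replace (snd (g p) - snd (g (1, 0))) with (Y - b) in H1 by (unfold Y, b; ring).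
    replace (fst (g p) - fst (g (0, 1))) with (X - c) in H2 by (unfold X, c; ring).
    replace (snd (g p) - snd (g (0, 1))) with (Y - d) in H2 by (unfold Y, d; ring).
    (* Polarization: subtracting [H1] from [H0] removes the squares and leaves the inner product of
       [(X, Y)] with [(a, b)]; likewise for [E2]. *)
    assert (E1 : a * X + b * Y = fst p) by nra.
    assert (E2 : c * X + d * Y = snd p) by nra.
    (* The matrix with columns [(a, b)] and [(c, d)] is orthogonal, so its rows are orthonormal too;
       this inverts the system [E1], [E2]. *)
    assert (I1 : a ^ 2 + c ^ 2 = 1).
    { rewrite Hc; transitivity (a ^ 2 + sg ^ 2 * b ^ 2); [ring | rewrite Hsg; lra]. }
    assert (I2 : b ^ 2 + d ^ 2 = 1).
    { rewrite Hd; transitivity (b ^ 2 + sg ^ 2 * a ^ 2); [ring | rewrite Hsg; lra]. }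
    assert (I3 : a * b + c * d = 0).
    { rewrite Hc, Hd; transitivity (a * b * (1 - sg ^ 2)); [ring | rewrite Hsg; ring]. }
    rewrite <- E1, <- E2; split.
    - transitivity ((a ^ 2 + c ^ 2) * X + (a * b + c * d) * Y);
        [rewrite I1, I3; ring | ring].
    - transitivity ((b ^ 2 + d ^ 2) * Y + (a * b + c * d) * X);
        [rewrite I2, I3; ring | ring]. }
  exists a, b, sg; split; [exact Hab1 | split; [exact Hsg |]].
  intros p q; destruct (L p) as [P1 P2], (L q) as [Q1 Q2].
  rewrite Hc in P1, Q1; rewrite Hd in P2, Q2.
  apply injective_projections; cbn.
  - transitivity ((fst (g p) - fst (g (0, 0))) - (fst (g q) - fst (g (0, 0))));
      [ring | rewrite P1, Q1; ring].
  - transitivity ((snd (g p) - snd (g (0, 0))) - (snd (g q) - snd (g (0, 0))));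
      [ring | rewrite P2, Q2; ring].
Qed.

Lemma eps_pos (N : nat) : (3 <= N)%nat -> 0 < eps N.
Proof. intros H; apply Rinv_0_lt_compat, lt_0_INR; lia. Qed.

(** From [N >= 3] one has [eps N < 1/2]. The upper bound makes [cos (PI * eps N)] positive, hence
    also the length [2 * F2 F N] of a second-neighbour bond. *)
Lemma half_angle_bounds (N : nat) : (3 <= N)%nat -> 0 < PI * eps N < PI / 2.
Proof.
  intros H; pose proof PI_RGT_0; pose proof (eps_pos N H).
  split; [apply Rmult_lt_0_compat; assumption|].
  unfold Rdiv; apply Rmult_lt_compat_l; [assumption|].
  apply Rinv_lt_contravar; apply le_INR in H; cbn in H; lra.
Qed.

(* [ss] is [sin (PI * eps N)] or its opposite, according to the orientation of the
   rigid motion. *)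
Lemma circle_frame (F : R) (N : nat) (y : Z -> vec) :
  (3 <= N)%nat -> uniform_circular F N y ->
  exists (t w : Z -> vec) (ss : R),
    cos (PI * eps N) ^ 2 + ss ^ 2 = 1 /\
    forall l : Z,
      dot (t l) (t l) = 1 /\ dot (w l) (w l) = 1 /\
      w (l + Z.of_nat N)%Z = w l /\
      bdiff N y l = scal F (t l) /\
      plus (bdiff N y (l + 1)%Z) (bdiff N y l) = scal (2 * F2 F N) (w l) /\
      w l = plus (scal (cos (PI * eps N)) (t l)) (scal ss (perp (t l))) /\
      w (l - 1)%Z = plus (scal (cos (PI * eps N)) (t l)) (scal (- ss) (perp (t l))).
Proof.
  intros HN (Rad & g & HR & Hg & Hy).
  destruct (rigid_motion_linear g Hg) as (a & b & sg & Hab & Hsg & L).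
  pose proof (eps_pos N HN) as He.
  set (de := PI * eps N) in *.
  (* The angle halfway between atoms [l - 1] and [l]: the chord joining them is parallel to the
     tangent there. The chord from [l - 1] to [l + 1] is parallel to the tangent at atom [l], whose
     angle is [be l + de]. *)
  set (be := fun l => 2 * PI * eps N * IZR l - de).
  set (t := fun l : Z => (a * - sin (be l) - sg * b * cos (be l),
                          b * - sin (be l) + sg * a * cos (be l))).
  set (w := fun l : Z => (a * - sin (be l + de) - sg * b * cos (be l + de),
                          b * - sin (be l + de) + sg * a * cos (be l + de))).
  assert (Hunit : forall x, dot (a * - sin x - sg * b * cos x, b * - sin x + sg * a * cos x)
     (a * - sin x - sg * b * cos x, b * - sin x + sg * a * cos x) = 1).
  { intros x; pose proof (sin2_cos2 x) as S; unfold Rsqr in S; unfold dot; cbn [fst snd].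
    transitivity ((a ^ 2 + b ^ 2) * (sin x * sin x + sg ^ 2 * (cos x * cos x))); [ring|].
    rewrite Hab, Hsg; lra. }
  assert (Hb1 : forall l, be (l + 1)%Z = be l + de + de).
  { intros l; unfold be, de; rewrite plus_IZR; ring. }
  assert (Hdiff : forall l, bdiff N y l = scal F (t l)).
  { intros l; unfold bdiff; rewrite !Hy, L.
    unfold circle; cbn [fst snd].
    replace (2 * PI * eps N * IZR l) with (be l + de) by (unfold be; ring).
    replace (2 * PI * eps N * IZR (l - 1)) with (be l - de)
      by (unfold be, de; rewrite minus_IZR; ring).
    rewrite cos_plus, cos_minus, sin_plus, sin_minus.
    assert (HF : F = / eps N * (2 * Rad * sin de)) by (rewrite <- HR; field; lra).
    apply injective_projections; cbn; unfold mult; cbn; rewrite HF; ring. }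
  exists t, w, (sg * sin de).
  split.
  { pose proof (sin2_cos2 de) as S; unfold Rsqr in S.
    transitivity (cos de * cos de + sg ^ 2 * (sin de * sin de)); [ring | rewrite Hsg; lra]. }
  (* The sign [s] treats [w l] and [w (l - 1)] together. The [sg] in the sine coefficient meets the
     [sg] inside [perp (t l)], and [sg ^ 2 = 1] closes the computation for both orientations. *)
  assert (Hw : forall l s, (s = 1 \/ s = -1) ->
     (a * - sin (be l + s * de) - sg * b * cos (be l + s * de),
      b * - sin (be l + s * de) + sg * a * cos (be l + s * de))
     = plus (scal (cos de) (t l)) (scal (s * (sg * sin de)) (perp (t l)))).
  { intros l s Hs.
    assert (C : cos (s * de) = cos de).
    { destruct Hs as [-> | ->]; [now rewrite Rmult_1_l|].
      replace (-1 * de) with (- de) by ring; apply cos_neg. }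
    assert (S : sin (s * de) = s * sin de).
    { destruct Hs as [-> | ->]; [now rewrite !Rmult_1_l|].
      replace (-1 * de) with (- de) by ring; rewrite sin_neg; ring. }
    rewrite sin_plus, cos_plus, C, S.
    apply injective_projections; cbn; unfold mult; cbn.
    - transitivity (cos de * (a * - sin (be l) - sg * b * cos (be l))
        + s * sin de * (- a * cos (be l) + sg * b * sin (be l))); [ring|].
      transitivity (cos de * (a * - sin (be l) - sg * b * cos (be l))
        + s * sin de * (- sg ^ 2 * a * cos (be l) + sg * b * sin (be l))); [rewrite Hsg; ring|ring].
    - transitivity (cos de * (b * - sin (be l) + sg * a * cos (be l))
        + s * sin de * (- b * cos (be l) - sg * a * sin (be l))); [ring|].
      transitivity (cos de * (b * - sin (be l) + sg * a * cos (be l))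
        + s * sin de * (- sg ^ 2 * b * cos (be l) - sg * a * sin (be l)));
        [rewrite Hsg; ring|ring]. }
  intros l; repeat split.
  - apply Hunit.
  - apply Hunit.
  - unfold w.
    replace (be (l + Z.of_nat N)%Z + de) with (be l + de + 2 * PI).
    + generalize (be l + de); intros x.
      now rewrite sin_plus, cos_plus, sin_2PI, cos_2PI, !Rmult_0_r, !Rmult_1_r,
        Rplus_0_r, Rminus_0_r.
    + unfold be; rewrite plus_IZR, <- INR_IZR_INZ; unfold eps; field.
      apply not_0_INR; lia.
  - apply Hdiff.
  - rewrite !Hdiff; unfold t, w, F2; fold de; rewrite Hb1.
    (* Centred at [x], the two bonds sit at [x - de] and [x + de]; the sine parts cancel and the
       factor [2 cos de] gives the length [2 * F2]. *)
    assert (Hx : exists x, be l = x - de) by (exists (be l + de); ring).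
    destruct Hx as [x ->]; replace (x - de + de) with x by ring.
    rewrite sin_plus, cos_plus, sin_minus, cos_minus.
    apply injective_projections; cbn; unfold mult; cbn; ring.
  - specialize (Hw l 1 (or_introl eq_refl)); rewrite !Rmult_1_l in Hw; exact Hw.
  - specialize (Hw l (-1) (or_intror eq_refl)).
    replace (- (sg * sin de)) with (-1 * (sg * sin de)) by ring.
    rewrite <- Hw; unfold w.
    replace (be (l - 1)%Z + de) with (be l + -1 * de); [reflexivity|].
    unfold be, de; rewrite minus_IZR; ring.
Qed.

(** * Discrete norms and bounds for frame forms *)

Lemma l2norm_norm (N : nat) (v : Z -> vec) :
  l2norm N v = sqrt (eps N * psum N (fun l => norm (v l) ^ 2)).
Proof.
  unfold l2norm, ip; do 2 f_equal.
  apply psum_ext; intros l; now rewrite norm_sqr.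
Qed.

Lemma l2norm_le (N : nat) (k : R) (v w : Z -> vec) :
  0 < eps N -> 0 <= k -> ip N v v <= k ^ 2 * ip N w w ->
  l2norm N v <= k * l2norm N w.
Proof.
  intros He Hk H; unfold l2norm.
  rewrite <- (sqrt_pow2 k) at 1 by exact Hk.
  rewrite <- sqrt_mult_alt by apply pow2_ge_0.
  now apply sqrt_le_1_alt.
Qed.

Lemma l2norm_nonneg (N : nat) (v : Z -> vec) : 0 <= l2norm N v.
Proof. apply sqrt_pos. Qed.

Lemma l2norm_sqr (N : nat) (v : Z -> vec) : 0 < eps N -> l2norm N v ^ 2 = ip N v v.
Proof.
  intros He; apply pow2_sqrt; apply Rmult_le_pos; [lra|].
  apply psum_nonneg; intros l; rewrite <- norm_sqr; apply pow2_ge_0.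
Qed.

Lemma l2norm_scal (N : nat) (c : R) (v : Z -> vec) :
  0 < eps N -> 0 <= c -> l2norm N (fun l => scal c (v l)) <= c * l2norm N v.
Proof.
  intros He Hc; apply l2norm_le; [exact He | exact Hc |].
  unfold ip; right.
  transitivity (eps N * (c ^ 2 * psum N (fun l => dot (v l) (v l)))); [|ring].
  rewrite <- (psum_scal N (c ^ 2)); f_equal; apply psum_ext; intros l.
  destruct (v l); unfold dot; cbn; unfold mult; cbn; ring.
Qed.

(** From [|x + y|^2 <= 2|x|^2 + 2|y|^2] and shift invariance of the sum. Applied to both arguments
    of a second-neighbour form it produces the factor 4 in front of [Cphi]. *)
Lemma l2norm_add_shift (N : nat) (v : Z -> vec) :
  0 < eps N -> (forall l, v (l + Z.of_nat N)%Z = v l) ->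
  l2norm N (fun l => plus (v (l + 1)%Z) (v l)) <= 2 * l2norm N v.
Proof.
  intros He per; apply l2norm_le; [exact He | lra |].
  unfold ip.
  assert (H : psum N (fun l => dot (plus (v (l + 1)%Z) (v l)) (plus (v (l + 1)%Z) (v l)))
    <= psum N (fun l => 2 * dot (v (l + 1)%Z) (v (l + 1)%Z) + 2 * dot (v l) (v l))).
  { apply psum_le; intros l.
    destruct (v (l + 1)%Z) as [x1 x2], (v l) as [y1 y2]; unfold dot; cbn.
    pose proof (pow2_ge_0 (x1 - y1)); pose proof (pow2_ge_0 (x2 - y2)); nra. }
  rewrite psum_plus, !psum_scal in H.
  rewrite (psum_shift N (fun l => dot (v l) (v l))) in H
    by (intros l; now rewrite per).
  nra.
Qed.

(** The form is diagonal in an orthonormal frame, so its operator norm is the larger of [|h|] and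
    [|k|]; the last step is Cauchy-Schwarz in the plane. *)
Lemma frame_form_bound (h k K : R) (t x e : vec) :
  dot t t = 1 -> Rabs h <= K -> Rabs k <= K ->
  Rabs (frame_form h k t x e) <= K * (norm x * norm e).
Proof.
  intros Ht Hh Hk.
  assert (HK : 0 <= K) by (pose proof (Rabs_pos h); lra).
  assert (P : forall z, dot z z = dot t z ^ 2 + dot (perp t) z ^ 2).
  { intros z; transitivity (dot t t * dot z z); [rewrite Ht; ring|].
    destruct t, z; unfold dot, perp; cbn; ring. }
  pose proof (norm_sqr x) as Nx; pose proof (norm_sqr e) as Ne.
  rewrite P in Nx, Ne.
  unfold frame_form.
  set (x1 := dot t x) in *; set (x2 := dot (perp t) x) in *.
  set (e1 := dot t e) in *; set (e2 := dot (perp t) e) in *.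
  eapply Rle_trans; [apply Rabs_triang|]; rewrite !Rabs_mult.
  apply Rle_trans with (K * (Rabs x1 * Rabs e1) + K * (Rabs x2 * Rabs e2)).
  - apply Rplus_le_compat; apply Rmult_le_compat_r; auto;
      apply Rmult_le_pos; apply Rabs_pos.
  - rewrite <- Rmult_plus_distr_l; apply Rmult_le_compat_l; [exact HK|].
    apply Rsqr_incr_0_var.
    + unfold Rsqr.
      replace (norm x * norm e * (norm x * norm e)) with (norm x ^ 2 * norm e ^ 2) by ring.
      rewrite Nx, Ne, <- (pow2_abs x1), <- (pow2_abs x2), <- (pow2_abs e1), <- (pow2_abs e2).
      pose proof (pow2_ge_0 (Rabs x1 * Rabs e2 - Rabs x2 * Rabs e1)); nra.
    + apply Rmult_le_pos; apply norm_ge_0.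
Qed.

Lemma frame_sum_bound (N : nat) (h k K : R) (t x e : Z -> vec) :
  0 < eps N -> (forall l, dot (t l) (t l) = 1) -> Rabs h <= K -> Rabs k <= K ->
  Rabs (eps N * psum N (fun l => frame_form h k (t l) (x l) (e l)))
  <= K * l2norm N x * l2norm N e.
Proof.
  intros He Ht Hh Hk.
  assert (HK : 0 <= K) by (pose proof (Rabs_pos h); lra).
  set (p := psum N (fun l => norm (x l) * norm (e l))).
  assert (H : Rabs (psum N (fun l => frame_form h k (t l) (x l) (e l))) <= K * p).
  { unfold p; rewrite <- psum_scal.
    apply Rle_trans with (psum N (fun l => Rabs (frame_form h k (t l) (x l) (e l)))).
    - apply (norm_sum_n_m (V := R_NormedModule)).
    - apply psum_le; intros l; now apply frame_form_bound. }
  rewrite Rabs_mult, (Rabs_right (eps N)) by lra.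
  apply Rle_trans with (K * (eps N * p)); [nra|].
  rewrite Rmult_assoc; apply Rmult_le_compat_l; [exact HK|].
  rewrite !l2norm_norm.
  assert (Hx : forall v : Z -> vec, 0 <= eps N * psum N (fun l => norm (v l) ^ 2)).
  { intros v; apply Rmult_le_pos; [lra|].
    apply psum_nonneg; intros l; apply pow2_ge_0. }
  rewrite <- sqrt_mult by apply Hx.
  rewrite <- (sqrt_pow2 (eps N * p)).
  - apply sqrt_le_1_alt.
    pose proof (psum_Cauchy_Schwarz N (fun l => norm (x l)) (fun l => norm (e l))) as CS.
    cbv beta in CS; fold p in CS.
    rewrite Rpow_mult_distr.
    replace (eps N * psum N (fun l => norm (x l) ^ 2) * (eps N * psum N (fun l => norm (e l) ^ 2)))
      with (eps N ^ 2 * (psum N (fun l => norm (x l) ^ 2) * psum N (fun l => norm (e l) ^ 2)))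
      by ring.
    apply Rmult_le_compat_l; [apply pow2_ge_0 | exact CS].
  - apply Rmult_le_pos; [lra|]; apply psum_nonneg; intros l.
    apply Rmult_le_pos; apply norm_ge_0.
Qed.

(** * Summation by parts and the resulting difference stencils *)

Lemma psum_shift_part (N : nat) (f g : Z -> R) :
  (forall l, g (l + Z.of_nat N)%Z = g l) ->
  psum N (fun l => f l + g (l + 1)%Z) = psum N (fun l => f l + g l).
Proof. intros per; rewrite !psum_plus; f_equal; now apply psum_shift. Qed.

Lemma dot_sum_by_parts (N : nat) (w e : Z -> vec) :
  (forall l, w (l + Z.of_nat N)%Z = w l) -> (forall l, e (l + Z.of_nat N)%Z = e l) ->
  psum N (fun l => dot (w l) (plus (e (l + 1)%Z) (e l)))
  = psum N (fun l => dot (w l) (e l) + dot (w (l - 1)%Z) (e l)).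
Proof.
  intros pw pe.
  rewrite <- (psum_shift_part N _ (fun l => dot (w (l - 1)%Z) (e l))).
  - apply psum_ext; intros l; rewrite Z.add_simpl_r.
    unfold dot; cbn; ring.
  - intros l; rewrite pe.
    replace (l + Z.of_nat N - 1)%Z with (l - 1 + Z.of_nat N)%Z by ring; now rewrite pw.
Qed.

(** Shifting the [e (l + 1)] half back by one index attaches to each [e l] the two bonds [w l] and
    [w (l - 1)], a stencil symmetric about [l]. *)
Lemma frame_sum_by_parts (N : nat) (h k : R) (w x e : Z -> vec) :
  (forall l, w (l + Z.of_nat N)%Z = w l) -> (forall l, x (l + Z.of_nat N)%Z = x l) ->
  (forall l, e (l + Z.of_nat N)%Z = e l) ->
  psum N (fun l => frame_form h k (w l) (plus (x (l + 1)%Z) (x l)) (plus (e (l + 1)%Z) (e l)))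
  = psum N (fun l => frame_form h k (w l) (plus (x (l + 1)%Z) (x l)) (e l)
      + frame_form h k (w (l - 1)%Z) (plus (x l) (x (l - 1)%Z)) (e l)).
Proof.
  intros pw px pe.
  rewrite <- (psum_shift_part N _
    (fun l => frame_form h k (w (l - 1)%Z) (plus (x l) (x (l - 1)%Z)) (e l))).
  - apply psum_ext; intros l; rewrite Z.add_simpl_r.
    unfold frame_form, dot; cbn; ring.
  - intros l; rewrite pe, px.
    replace (l + Z.of_nat N - 1)%Z with (l - 1 + Z.of_nat N)%Z by ring.
    now rewrite pw, px.
Qed.

(* Pointwise form of the residual after summation by parts.  The three terms on the
   right are of size eps^2 times u', u''' and u'' respectively. *)
Lemma stencil_identity (A B cc ss : R) (t w w' up u um e : vec) :
  cc ^ 2 + ss ^ 2 = 1 ->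
  w = plus (scal cc t) (scal ss (perp t)) ->
  w' = plus (scal cc t) (scal (- ss) (perp t)) ->
  frame_form (4 * A) (4 * B) t u e
  - (frame_form A B w (plus up u) e + frame_form A B w' (plus u um) e)
  = frame_form (4 * ss ^ 2 * (A - B)) (- (4 * ss ^ 2 * (A - B))) t u e
    + frame_form (- (A * cc ^ 2 + B * ss ^ 2)) (- (A * ss ^ 2 + B * cc ^ 2)) t
        (plus (minus up u) (minus um u)) e
    + frame_form ((A - B) * (cc * ss)) (- ((A - B) * (cc * ss))) t
        (perp (minus up um)) e.
Proof.
  intros H -> ->.
  (* Multiplying by [cc ^ 2 + ss ^ 2 = 1] makes every term quadratic in [(cc, ss)], so that the
     identity becomes a polynomial one. *)
  replace (frame_form (4 * A) (4 * B) t u e)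
    with ((cc ^ 2 + ss ^ 2) * frame_form (4 * A) (4 * B) t u e) by (rewrite H; ring).
  unfold frame_form, dot, perp; cbn; unfold mult; cbn; ring.
Qed.

Lemma bdiff_periodic (N : nat) (u : Z -> vec) :
  (forall l, u (l + Z.of_nat N)%Z = u l) ->
  forall l, bdiff N u (l + Z.of_nat N)%Z = bdiff N u l.
Proof.
  intros H l; unfold bdiff.
  replace (l + Z.of_nat N - 1)%Z with (l - 1 + Z.of_nat N)%Z by ring.
  now rewrite !H.
Qed.

Lemma bdiff_perturb (N : nat) (y : Z -> vec) (t : R) (u : Z -> vec) (l : Z) :
  bdiff N (perturb y t u) l = plus (bdiff N y l) (scal t (bdiff N u l)).
Proof.
  unfold bdiff, perturb; apply injective_projections; cbn; unfold mult; cbn; ring.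
Qed.

Lemma bdiff_minus (N : nat) (u v : Z -> vec) (l : Z) :
  bdiff N (fun l => minus (u l) (v l)) l = minus (bdiff N u l) (bdiff N v l).
Proof.
  unfold bdiff; apply injective_projections; cbn; unfold mult; cbn; ring.
Qed.

(** The backward third difference at [l + 1] is, on [u'], the second difference centred at [l];
    hence the shifted index. *)
Lemma second_difference (N : nat) (u : Z -> vec) (l : Z) :
  eps N <> 0 ->
  plus (minus (bdiff N u (l + 1)%Z) (bdiff N u l))
       (minus (bdiff N u (l - 1)%Z) (bdiff N u l))
  = scal (eps N ^ 2) (bdiff_n N 3 u (l + 1)%Z).
Proof.
  intros He; cbn [bdiff_n]; generalize (bdiff N u) as z; intros z.
  unfold bdiff; rewrite Z.add_simpl_r.
  apply injective_projections; cbn; unfold mult; cbn; field; exact He.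
Qed.

Lemma central_difference (N : nat) (u : Z -> vec) (l : Z) :
  eps N <> 0 ->
  minus (bdiff N u (l + 1)%Z) (bdiff N u (l - 1)%Z)
  = scal (eps N) (plus (bdiff_n N 2 u (l + 1)%Z) (bdiff_n N 2 u l)).
Proof.
  intros He; cbn [bdiff_n]; generalize (bdiff N u) as z; intros z.
  unfold bdiff; rewrite Z.add_simpl_r.
  apply injective_projections; cbn; unfold mult; cbn; field; exact He.
Qed.

Lemma in_U_minus (N : nat) (u v : Z -> vec) :
  in_U N u -> in_U N v -> in_U N (fun l => minus (u l) (v l)).
Proof.
  intros [pu su] [pv sv]; split.
  - intros l; now rewrite pu, pv.
  - assert (H : forall n, psum n (fun l => minus (u l) (v l)) = minus (psum n u) (psum n v)).
    { induction n as [|n IH].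
      - unfold psum; rewrite !sum_n_m_zero by lia.
        apply injective_projections; cbn; ring.
      - rewrite !psum_S, IH.
        apply injective_projections; cbn; ring. }
    rewrite H, su, sv; apply injective_projections; cbn; ring.
Qed.

(** * First and second variations of the two energies at the circle *)

Lemma C3_pos_is_derive (phi : R -> R) (r : R) :
  C3_pos phi -> 0 < r ->
  is_derive phi r (dphi phi r) /\ is_derive (dphi phi) r (ddphi phi r).
Proof.
  intros H Hr; split; apply Derive_correct.
  - exact (proj1 (H 1%nat r ltac:(lia) Hr)).
  - exact (proj1 (H 2%nat r ltac:(lia) Hr)).
Qed.

Lemma is_derive_double (f : R -> R) (r d : R) :
  is_derive f (2 * r) d -> is_derive (fun x => f (2 * x)) r (2 * d).
Proof.
  intros H.
  apply (is_derive_comp (K := R_AbsRing) (V := R_NormedModule) f (fun x => 2 * x) r d 2).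
  - exact H.
  - auto_derive; [exact I | ring].
Qed.

Section Variations.
Variables (phi : R -> R) (F : R) (N : nat) (y t w : Z -> vec).
Hypothesis Hphi : C3_pos phi.
Hypotheses (HF : 0 < F) (HF2 : 0 < F2 F N).
Hypotheses (Ht : forall l, dot (t l) (t l) = 1) (Hw : forall l, dot (w l) (w l) = 1).
Hypothesis Hyt : forall l, bdiff N y l = scal F (t l).
Hypothesis Hyw :
  forall l, plus (bdiff N y (l + 1)%Z) (bdiff N y l) = scal (2 * F2 F N) (w l).

Let plus_bdiff_perturb (z : Z -> vec) (s : R) (u : Z -> vec) (l : Z) :
  plus (bdiff N (perturb z s u) (l + 1)%Z) (bdiff N (perturb z s u) l)
  = plus (plus (bdiff N z (l + 1)%Z) (bdiff N z l))
         (scal s (plus (bdiff N u (l + 1)%Z) (bdiff N u l))).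
Proof.
  rewrite !bdiff_perturb; apply injective_projections; cbn; unfold mult; cbn; ring.
Qed.

Let D1 (r : R) (Hr : 0 < r) := proj1 (C3_pos_is_derive phi r Hphi Hr).
Let D2 (r : R) (Hr : 0 < r) := proj2 (C3_pos_is_derive phi r Hphi Hr).

Let D1' (r : R) : 0 < r -> is_derive (fun x => phi (2 * x)) r (2 * dphi phi (2 * r)).
Proof. intros Hr; apply is_derive_double, D1; lra. Qed.

Let D2' (r : R) :
  0 < r -> is_derive (fun x => 2 * dphi phi (2 * x)) r (4 * ddphi phi (2 * r)).
Proof.
  intros Hr; replace (4 * ddphi phi (2 * r)) with (2 * (2 * ddphi phi (2 * r))) by ring.
  apply is_derive_scal, is_derive_double, D2; lra.
Qed.

Lemma var1_Ea (v : Z -> vec) :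
  var1 (Ea phi N) y v = eps N * psum N (fun l =>
    dphi phi F * dot (t l) (bdiff N v l)
    + dphi phi (2 * F2 F N) * dot (w l) (plus (bdiff N v (l + 1)%Z) (bdiff N v l))).
Proof.
  apply (var1_energy phi (dphi phi) phi (dphi phi) D1 D1 N (bdiff N)
    (fun z l => plus (bdiff N z (l + 1)%Z) (bdiff N z l))
    (bdiff_perturb N) plus_bdiff_perturb y t w F (2 * F2 F N)); auto; lra.
Qed.

Lemma var2_Ea (u v : Z -> vec) :
  var2 (Ea phi N) y u v = eps N * psum N (fun l =>
    frame_form (ddphi phi F) (dphi phi F / F) (t l) (bdiff N u l) (bdiff N v l)
    + frame_form (ddphi phi (2 * F2 F N)) (dphi phi (2 * F2 F N) / (2 * F2 F N)) (w l)
        (plus (bdiff N u (l + 1)%Z) (bdiff N u l))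
        (plus (bdiff N v (l + 1)%Z) (bdiff N v l))).
Proof.
  apply (var2_energy phi (dphi phi) (ddphi phi) phi (dphi phi) (ddphi phi) D1 D2 D1 D2
    N (bdiff N) (fun z l => plus (bdiff N z (l + 1)%Z) (bdiff N z l))
    (bdiff_perturb N) plus_bdiff_perturb y t w F (2 * F2 F N)); auto; lra.
Qed.

Lemma var1_ECB (v : Z -> vec) :
  var1 (ECB phi N) y v = eps N * psum N (fun l =>
    dphi phi F * dot (t l) (bdiff N v l)
    + 2 * dphi phi (2 * F) * dot (t l) (bdiff N v l)).
Proof.
  apply (var1_energy phi (dphi phi) (fun x => phi (2 * x)) (fun x => 2 * dphi phi (2 * x))
    D1 D1' N (bdiff N) (bdiff N) (bdiff_perturb N) (bdiff_perturb N) y t t F F); auto.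
Qed.

Lemma var2_ECB (u v : Z -> vec) :
  var2 (ECB phi N) y u v = eps N * psum N (fun l =>
    frame_form (ddphi phi F) (dphi phi F / F) (t l) (bdiff N u l) (bdiff N v l)
    + frame_form (4 * ddphi phi (2 * F)) (2 * dphi phi (2 * F) / F)
        (t l) (bdiff N u l) (bdiff N v l)).
Proof.
  apply (var2_energy phi (dphi phi) (ddphi phi) (fun x => phi (2 * x))
    (fun x => 2 * dphi phi (2 * x)) (fun x => 4 * ddphi phi (2 * x)) D1 D2 D1' D2'
    N (bdiff N) (bdiff N) (bdiff_perturb N) (bdiff_perturb N) y t t F F); auto.
Qed.
End Variations.

(** * Consistency of the first and second variations *)

(** The diagonal entries of a rotated form with eigenvalues [A], [B] are convex combinations of
    them; such entries multiply the [u'''] term. *)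
Lemma Rabs_convex_combination (A B m c s : R) :
  Rabs A <= m -> Rabs B <= m -> c ^ 2 + s ^ 2 = 1 ->
  Rabs (- (A * c ^ 2 + B * s ^ 2)) <= m.
Proof.
  intros HA HB H; rewrite Rabs_Ropp.
  pose proof (pow2_ge_0 c); pose proof (pow2_ge_0 s).
  apply Rabs_le; apply Rabs_le_between in HA; apply Rabs_le_between in HB; nra.
Qed.

Lemma l2norm_ext (N : nat) (v w : Z -> vec) :
  (forall l, dot (v l) (v l) = dot (w l) (w l)) -> l2norm N v = l2norm N w.
Proof.
  intros H; unfold l2norm, ip; do 2 f_equal; now apply psum_ext.
Qed.

Section Consistency.
Variables (N : nat) (t w : Z -> vec) (cc ss : R).
Hypothesis HN : (3 <= N)%nat.
Hypothesis Hcs : cc ^ 2 + ss ^ 2 = 1.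
Hypothesis Hss : ss ^ 2 <= (PI * eps N) ^ 2.
Hypothesis Ht : forall l, dot (t l) (t l) = 1.
Hypothesis Hw : forall l, dot (w l) (w l) = 1.
Hypothesis Hper : forall l, w (l + Z.of_nat N)%Z = w l.
Hypothesis Hwt : forall l, w l = plus (scal cc (t l)) (scal ss (perp (t l))).
Hypothesis Hwt' : forall l, w (l - 1)%Z = plus (scal cc (t l)) (scal (- ss) (perp (t l))).

Let He : 0 < eps N := eps_pos N HN.

Lemma l2norm_frame : l2norm N t = 1.
Proof.
  unfold l2norm, ip.
  replace (psum N (fun l => dot (t l) (t l))) with (INR N * 1).
  - unfold eps; rewrite Rmult_1_r, Rinv_l; [apply sqrt_1 | apply not_0_INR; lia].
  - symmetry; rewrite (psum_ext _ _ (fun _ => 1)) by exact Ht.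
    unfold psum; rewrite sum_n_m_const; do 2 f_equal; lia.
Qed.

(** Since [perp t] is orthogonal to [t], the product [t.e] is the frame form with unit coefficients
    at [(t, e)], and [t] has norm 1. *)
Lemma tangent_sum_bound (e : Z -> vec) :
  Rabs (eps N * psum N (fun l => dot (t l) (e l))) <= l2norm N e.
Proof.
  rewrite (psum_ext _ _ (fun l => frame_form 1 1 (t l) (t l) (e l))).
  - pose proof (frame_sum_bound N 1 1 1 t t e He Ht) as H.
    rewrite l2norm_frame, Rmult_1_l, Rmult_1_l in H; apply H; rewrite Rabs_R1; lra.
  - intros l; unfold frame_form; rewrite Ht.
    unfold dot, perp; cbn; ring.
Qed.

Lemma Rabs_half_angle_sin : Rabs ss <= PI * eps N.
Proof.
  assert (Hp : 0 < PI * eps N) by (apply Rmult_lt_0_compat; [apply PI_RGT_0 | exact He]).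
  revert Hss; generalize dependent (PI * eps N); intros p Hp Hss.
  apply Rabs_le; split; nra.
Qed.

(** Here [w l + w (l - 1) = 2 cc t l], so both sums are multiples of the same one. The assumption
    controls [phi'(r)/r] rather than [phi'], so [P] and [P2] are expressed through [B] and [B2]. *)
Lemma first_variation_consistency (P P2 r Cphi : R) (e : Z -> vec) :
  0 < r -> 0 < cc ->
  Rabs (P2 / (2 * (r * cc)) - P / (2 * r)) <= Cphi * eps N ^ 2 ->
  (forall l, e (l + Z.of_nat N)%Z = e l) ->
  Rabs (eps N * psum N (fun l => 2 * P * dot (t l) (e l))
        - eps N * psum N (fun l => P2 * dot (w l) (plus (e (l + 1)%Z) (e l))))
  <= (4 * Cphi * r + 2 * PI ^ 2 * Rabs P) * eps N ^ 2 * l2norm N e.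
Proof.
  intros Hr Hcc HP pe.
  set (B := P / (2 * r)) in *; set (B2 := P2 / (2 * (r * cc))) in *.
  assert (EP : P = 2 * r * B) by (unfold B; field; lra).
  assert (EP2 : P2 = 2 * (r * cc) * B2) by (unfold B2; field; lra).
  replace (psum N (fun l => P2 * dot (w l) (plus (e (l + 1)%Z) (e l))))
    with (2 * cc * P2 * psum N (fun l => dot (t l) (e l))).
  2:{ rewrite (psum_scal N P2), dot_sum_by_parts, <- psum_scal, <- psum_scal by assumption.
      apply psum_ext; intros l; rewrite Hwt', Hwt.
      unfold dot; cbn; unfold mult; cbn; ring. }
  rewrite (psum_scal N (2 * P)).
  set (p := eps N * psum N (fun l => dot (t l) (e l))).
  (* [2 P - 2 cc P2], with [P] first split by [cc ^ 2 + ss ^ 2 = 1]: the [ss ^ 2] part yields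
     [2 PI ^ 2 |P|], the other [4 Cphi r]. *)
  replace (_ - _) with ((2 * P * ss ^ 2 - 4 * r * cc ^ 2 * (B2 - B)) * p).
  2:{ unfold p.
      transitivity ((2 * P - 2 * cc * P2) * (eps N * psum N (fun l => dot (t l) (e l)))); [|ring].
      f_equal; rewrite EP2.
      transitivity (2 * P * (cc ^ 2 + ss ^ 2) - 4 * r * cc ^ 2 * B2); [rewrite EP; ring|].
      rewrite Hcs; ring. }
  pose proof (tangent_sum_bound e) as T; fold p in T.
  rewrite Rabs_mult.
  apply Rmult_le_compat; try apply Rabs_pos; [|exact T].
  eapply Rle_trans; [apply Rabs_triang|].
  rewrite Rabs_Ropp, !Rabs_mult, (Rabs_right (4)), (Rabs_right 2), (Rabs_right r),
    (Rabs_right (ss ^ 2)), (Rabs_right (cc ^ 2)); try lra;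
    try (apply Rle_ge, pow2_ge_0).
  pose proof (pow2_ge_0 ss); pose proof (pow2_ge_0 cc).
  pose proof (Rabs_pos P); pose proof (Rabs_pos (B2 - B)).
  assert (I1 : Rabs P * ss ^ 2 <= Rabs P * (PI * eps N) ^ 2)
    by (apply Rmult_le_compat_l; assumption).
  assert (I2 : cc ^ 2 * Rabs (B2 - B) <= 1 * (Cphi * eps N ^ 2))
    by (apply Rmult_le_compat; lra).
  assert (I3 : r * (cc ^ 2 * Rabs (B2 - B)) <= r * (1 * (Cphi * eps N ^ 2)))
    by (apply Rmult_le_compat_l; lra).
  nra.
Qed.

Lemma second_variation_consistency (A B A2 B2 C : R) (u e : Z -> vec) :
  (forall l, u (l + Z.of_nat N)%Z = u l) -> (forall l, e (l + Z.of_nat N)%Z = e l) ->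
  Rabs (A2 - A) <= C -> Rabs (B2 - B) <= C ->
  Rabs (eps N * psum N (fun l => frame_form (4 * A) (4 * B) (t l) (bdiff N u l) (e l))
        - eps N * psum N (fun l => frame_form A2 B2 (w l)
            (plus (bdiff N u (l + 1)%Z) (bdiff N u l)) (plus (e (l + 1)%Z) (e l))))
  <= (4 * C * l2norm N (bdiff_n N 1 u)
      + (4 * PI ^ 2 * Rabs (A - B) * l2norm N (bdiff_n N 1 u)
         + 2 * PI * Rabs (A - B) * l2norm N (bdiff_n N 2 u)
         + Rmax (Rabs A) (Rabs B) * l2norm N (bdiff_n N 3 u)) * eps N ^ 2) * l2norm N e.
Proof.
  intros pu pe HA HB.
  set (m := Rmax (Rabs A) (Rabs B)).
  set (n1 := l2norm N (bdiff_n N 1 u)); set (n2 := l2norm N (bdiff_n N 2 u)).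
  set (n3 := l2norm N (bdiff_n N 3 u)); set (ne := l2norm N e).
  assert (Hne : 0 <= ne) by apply l2norm_nonneg.
  assert (Hn1 : 0 <= n1) by apply l2norm_nonneg.
  assert (pU : forall l, bdiff N u (l + Z.of_nat N)%Z = bdiff N u l)
    by now apply bdiff_periodic.
  set (U2 := fun l => scal (eps N) (plus (bdiff_n N 2 u (l + 1)%Z) (bdiff_n N 2 u l))).
  set (U3 := fun l => scal (eps N ^ 2) (bdiff_n N 3 u (l + 1)%Z)).
  set (X := fun l => plus (bdiff N u (l + 1)%Z) (bdiff N u l)).
  set (Y := fun l => plus (e (l + 1)%Z) (e l)).
  set (k1 := 4 * ss ^ 2 * (A - B)); set (k2 := (A - B) * (cc * ss)).
  (* [T0] replaces the coefficients at [2 * F2] by those at [2 * F]. Of the geometric terms, [T1]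
     gains its two powers of [eps] from [ss ^ 2], [T2] one from [ss] and one from [U2], and [T3]
     both from [U3]. *)
  set (T0 := eps N * psum N (fun l => frame_form (A - A2) (B - B2) (w l) (X l) (Y l))).
  set (T1 := eps N * psum N (fun l => frame_form k1 (- k1) (t l) (bdiff N u l) (e l))).
  set (T2 := eps N * psum N (fun l => frame_form k2 (- k2) (t l) (perp (U2 l)) (e l))).
  set (T3 := eps N * psum N (fun l => frame_form (- (A * cc ^ 2 + B * ss ^ 2))
               (- (A * ss ^ 2 + B * cc ^ 2)) (t l) (U3 l) (e l))).
  assert (Split : eps N * psum N (fun l => frame_form (4 * A) (4 * B) (t l) (bdiff N u l) (e l))
        - eps N * psum N (fun l => frame_form A2 B2 (w l) (X l) (Y l)) = T0 + (T1 + T3 + T2)).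
  { unfold T0, T1, T2, T3.
    rewrite <- !Rmult_plus_distr_l, <- Rmult_minus_distr_l; f_equal.
    assert (Q : psum N (fun l => frame_form A B (w l) (X l) (Y l))
              + psum N (fun l => frame_form k1 (- k1) (t l) (bdiff N u l) (e l)
        + frame_form (- (A * cc ^ 2 + B * ss ^ 2)) (- (A * ss ^ 2 + B * cc ^ 2)) (t l) (U3 l) (e l)
        + frame_form k2 (- k2) (t l) (perp (U2 l)) (e l))
      = psum N (fun l => frame_form (4 * A) (4 * B) (t l) (bdiff N u l) (e l))).
    { unfold X, Y; rewrite frame_sum_by_parts, <- psum_plus by assumption.
      apply psum_ext; intros l.
      unfold U2, U3; rewrite <- central_difference, <- second_difference by lra.
      pose proof (stencil_identity A B cc ss (t l) (w l) (w (l - 1)%Z)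
        (bdiff N u (l + 1)%Z) (bdiff N u l) (bdiff N u (l - 1)%Z) (e l) Hcs (Hwt l) (Hwt' l)) as S.
      fold k1 k2 in S; lra. }
    assert (Q' : psum N (fun l => frame_form A B (w l) (X l) (Y l))
      = psum N (fun l => frame_form A2 B2 (w l) (X l) (Y l))
        + psum N (fun l => frame_form (A - A2) (B - B2) (w l) (X l) (Y l))).
    { rewrite <- psum_plus; apply psum_ext; intros l; unfold frame_form; ring. }
    rewrite !psum_plus in Q; lra. }
  unfold X, Y in Split; rewrite Split; clear Split.
  assert (B0 : Rabs T0 <= C * (2 * n1) * (2 * ne)).
  { assert (HC : 0 <= C) by (pose proof (Rabs_pos (A2 - A)); lra).
    eapply Rle_trans.
    - apply (frame_sum_bound N (A - A2) (B - B2) C w X Y He Hw);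
        rewrite Rabs_minus_sym; assumption.
    - apply Rmult_le_compat; try apply l2norm_nonneg.
      + apply Rmult_le_pos; [exact HC | apply l2norm_nonneg].
      + apply Rmult_le_compat_l; [exact HC|]; now apply l2norm_add_shift.
      + now apply l2norm_add_shift. }
  assert (K1 : Rabs k1 <= 4 * PI ^ 2 * eps N ^ 2 * Rabs (A - B)).
  { unfold k1; rewrite !Rabs_mult, (Rabs_right 4), (Rabs_right (ss ^ 2)) by
      (try lra; apply Rle_ge, pow2_ge_0).
    apply Rmult_le_compat_r; [apply Rabs_pos | nra]. }
  assert (B1 : Rabs T1 <= 4 * PI ^ 2 * eps N ^ 2 * Rabs (A - B) * n1 * ne).
  { apply frame_sum_bound; auto; now rewrite Rabs_Ropp. }
  assert (K2 : Rabs k2 <= Rabs (A - B) * (PI * eps N)).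
  { unfold k2; rewrite !Rabs_mult.
    apply Rmult_le_compat_l; [apply Rabs_pos|].
    assert (Hc : Rabs cc <= 1) by (apply Rabs_le; split; nra).
    pose proof Rabs_half_angle_sin.
    pose proof (Rabs_pos cc); pose proof (Rabs_pos ss).
    rewrite <- (Rmult_1_l (PI * eps N)); now apply Rmult_le_compat. }
  assert (N2 : l2norm N (fun l => perp (U2 l)) <= eps N * (2 * n2)).
  { rewrite (l2norm_ext _ _ U2) by (intros l; unfold dot, perp; cbn; ring).
    eapply Rle_trans; [apply l2norm_scal; lra|].
    apply Rmult_le_compat_l; [lra|].
    apply l2norm_add_shift; [exact He|].
    now apply bdiff_periodic. }
  assert (B2' : Rabs T2 <= Rabs (A - B) * (PI * eps N) * (eps N * (2 * n2)) * ne).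
  { eapply Rle_trans.
    - apply (frame_sum_bound N k2 (- k2) (Rabs (A - B) * (PI * eps N)) t
        (fun l => perp (U2 l)) e He Ht); [exact K2 | now rewrite Rabs_Ropp].
    - apply Rmult_le_compat_r; [exact Hne|].
      apply Rmult_le_compat_l; [|exact N2].
      pose proof (Rabs_pos k2); lra. }
  assert (N3 : l2norm N U3 <= eps N ^ 2 * n3).
  { unfold U3; eapply Rle_trans; [apply l2norm_scal; [exact He | apply pow2_ge_0]|].
    right; f_equal; unfold n3, l2norm, ip; do 2 f_equal.
    (* Periodicity of the third difference absorbs the index [l + 1] in [U3]. *)
    apply (psum_shift N (fun l => dot (bdiff_n N 3 u l) (bdiff_n N 3 u l))).
    intros l; cbn [bdiff_n]; rewrite !bdiff_periodic; auto; now apply bdiff_periodic. }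
  assert (B3 : Rabs T3 <= m * (eps N ^ 2 * n3) * ne).
  { eapply Rle_trans.
    - apply (frame_sum_bound N _ _ m t U3 e He Ht).
      + apply Rabs_convex_combination; [apply Rmax_l | apply Rmax_r | exact Hcs].
      + apply Rabs_convex_combination with (c := ss) (s := cc);
          [apply Rmax_l | apply Rmax_r | lra].
    - apply Rmult_le_compat_r; [exact Hne|].
      apply Rmult_le_compat_l; [|exact N3].
      apply Rle_trans with (Rabs A); [apply Rabs_pos | apply Rmax_l]. }
  eapply Rle_trans; [apply Rabs_triang|].
  eapply Rle_trans; [apply Rplus_le_compat_l, Rabs_triang|].
  eapply Rle_trans; [apply Rplus_le_compat_l, Rplus_le_compat_r, Rabs_triang|].
  lra.
Qed.
End Consistency.

(** * Coercivity and the error estimate *)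

Lemma ECB_coercive (phi : R -> R) (F : R) (N : nat) (t e : Z -> vec) :
  0 < F -> 0 < eps N -> (forall l, dot (t l) (t l) = 1) ->
  gamma2 phi F * l2norm N e ^ 2
  <= eps N * psum N (fun l =>
       frame_form (ddphi phi F) (dphi phi F / F) (t l) (e l) (e l)
       + frame_form (4 * ddphi phi (2 * F)) (2 * dphi phi (2 * F) / F) (t l) (e l) (e l)).
Proof.
  intros HF He Ht; rewrite l2norm_sqr by exact He; unfold ip.
  rewrite <- Rmult_assoc, (Rmult_comm (gamma2 phi F)), Rmult_assoc, <- psum_scal.
  apply Rmult_le_compat_l; [lra|].
  apply psum_le; intros l.
  replace (dot (e l) (e l)) with (dot (t l) (e l) ^ 2 + dot (perp (t l)) (e l) ^ 2).
  - pose proof (Rmin_l (ddphi phi F + 4 * ddphi phi (2 * F))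
                       ((dphi phi F + 2 * dphi phi (2 * F)) / F)) as G1.
    pose proof (Rmin_r (ddphi phi F + 4 * ddphi phi (2 * F))
                       ((dphi phi F + 2 * dphi phi (2 * F)) / F)) as G2.
    fold (gamma2 phi F) in G1, G2.
    replace ((dphi phi F + 2 * dphi phi (2 * F)) / F)
      with (dphi phi F / F + 2 * dphi phi (2 * F) / F) in G2 by (field; lra).
    apply Rmult_le_compat_r with (r := dot (t l) (e l) ^ 2) in G1; [|apply pow2_ge_0].
    apply Rmult_le_compat_r with (r := dot (perp (t l)) (e l) ^ 2) in G2;
      [|apply pow2_ge_0].
    unfold frame_form; lra.
  - transitivity (dot (t l) (t l) * dot (e l) (e l)); [|rewrite Ht; ring].
    destruct (t l), (e l); unfold dot, perp; cbn; ring.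
Qed.

Theorem theorem8p3 :
  forall (phi : R -> R) (F Cphi : R),
    0 < F ->
    C3_pos phi ->
    is_Cphi phi F Cphi ->
    0 < gamma2 phi F ->
  forall (N : nat) (yF f ua uCB : Z -> R * R),
    (3 <= N)%nat ->
    uniform_circular F N yF ->
    in_U N f -> in_U N ua -> in_U N uCB ->
    (forall v : Z -> R * R, in_U N v ->
       var1 (Ea phi N) yF v + var2 (Ea phi N) yF ua v = ip N f v) ->
    (forall v : Z -> R * R, in_U N v ->
       var1 (ECB phi N) yF v + var2 (ECB phi N) yF uCB v = ip N f v) ->
    l2norm N (bdiff N (fun l => minus (ua l) (uCB l)))
    <= / gamma2 phi F *
       (Ckappa phi F Cphi N * eps N ^ 2
        + (C1 phi F Cphi * eps N ^ 2 + C2 Cphi * eps N ^ 4)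
          * (l2norm N (bdiff_n N 3 ua) + l2norm N (bdiff_n N 2 ua)
             + l2norm N (bdiff_n N 1 ua))).
Proof.
  intros phi F Cphi HF Hphi [HC HCphi] Hg N yF f ua uCB HN Hy Uf Ua Uc Ha Hc.
  pose proof (eps_pos N HN) as He.
  pose proof PI2_1 as HPI.
  destruct (half_angle_bounds N HN) as [Hd1 Hd2].
  destruct (circle_frame F N yF HN Hy) as (t & w & ss & Hcs & Hfr).
  assert (Hcc : 0 < cos (PI * eps N)) by (apply cos_gt_0; lra).
  assert (HF2 : 0 < F2 F N) by (apply Rmult_lt_0_compat; assumption).
  assert (Hss : ss ^ 2 <= (PI * eps N) ^ 2).
  { pose proof (sin2_cos2 (PI * eps N)) as S; unfold Rsqr in S.
    pose proof (sin_lt_x _ Hd1).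
    assert (0 < sin (PI * eps N)) by (apply sin_gt_0; lra).
    replace (ss ^ 2) with (sin (PI * eps N) ^ 2) by lra.
    apply pow_incr; lra. }
  assert (Ht : forall l, dot (t l) (t l) = 1) by (intros l; apply (Hfr l)).
  assert (Hw : forall l, dot (w l) (w l) = 1) by (intros l; apply (Hfr l)).
  assert (Hper : forall l, w (l + Z.of_nat N)%Z = w l) by (intros l; apply (Hfr l)).
  assert (Hyt : forall l, bdiff N yF l = scal F (t l)) by (intros l; apply (Hfr l)).
  assert (Hyw : forall l, plus (bdiff N yF (l + 1)%Z) (bdiff N yF l) = scal (2 * F2 F N) (w l))
    by (intros l; apply (Hfr l)).
  assert (Hwt : forall l, w l = plus (scal (cos (PI * eps N)) (t l)) (scal ss (perp (t l))))
    by (intros l; apply (Hfr l)).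
  assert (Hwt' : forall l, w (l - 1)%Z
      = plus (scal (cos (PI * eps N)) (t l)) (scal (- ss) (perp (t l))))
    by (intros l; apply (Hfr l)).
  set (u := fun l => minus (ua l) (uCB l)).
  assert (Uu : in_U N u) by (now apply in_U_minus).
  specialize (Ha u Uu); specialize (Hc u Uu).
  rewrite (var1_Ea phi F N yF t w), (var2_Ea phi F N yF t w) in Ha by assumption.
  rewrite (var1_ECB phi F N yF t), (var2_ECB phi F N yF t) in Hc by assumption.
  assert (Pe : forall l, bdiff N u (l + Z.of_nat N)%Z = bdiff N u l)
    by (apply bdiff_periodic, Uu).
  pose proof (ECB_coercive phi F N t (bdiff N u) HF He Ht) as Coer.
  specialize (HCphi N HN).
  pose proof (Rle_trans _ _ _ (Rmax_l _ _) HCphi) as HA.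
  pose proof (Rle_trans _ _ _ (Rmax_r _ _) HCphi) as HB.
  clear HCphi Hfr.
  pose proof (first_variation_consistency N t w _ ss HN Hcs Hss Ht Hper Hwt Hwt'
    (dphi phi (2 * F)) (dphi phi (2 * F2 F N)) F Cphi (bdiff N u) HF Hcc HB Pe) as FV.
  pose proof (second_variation_consistency N t w _ ss HN Hcs Hss Ht Hw Hper Hwt Hwt'
    (ddphi phi (2 * F)) (dphi phi (2 * F) / (2 * F)) (ddphi phi (2 * F2 F N))
    (dphi phi (2 * F2 F N) / (2 * F2 F N)) (Cphi * eps N ^ 2) ua (bdiff N u)
    (proj1 Ua) Pe HA HB) as SV.
  (* Linearity in the first slot, to expand the coercive form at the error into its values at [ua]
     and [uCB]. *)
  assert (Lin : forall h k, psum N (fun l => frame_form h k (t l) (bdiff N u l) (bdiff N u l))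
     = psum N (fun l => frame_form h k (t l) (bdiff N ua l) (bdiff N u l))
       - psum N (fun l => frame_form h k (t l) (bdiff N uCB l) (bdiff N u l))).
  { intros h k.
    assert (S : psum N (fun l => frame_form h k (t l) (bdiff N ua l) (bdiff N u l))
      = psum N (fun l => frame_form h k (t l) (bdiff N u l) (bdiff N u l))
        + psum N (fun l => frame_form h k (t l) (bdiff N uCB l) (bdiff N u l))).
    { rewrite <- psum_plus; apply psum_ext; intros l.
      replace (bdiff N ua l) with (plus (bdiff N u l) (bdiff N uCB l)).
      - generalize (bdiff N u l), (bdiff N uCB l); intros p q.
        unfold frame_form, dot; cbn; ring.
      - unfold u; rewrite bdiff_minus; apply injective_projections; cbn; ring. }
    lra. }
  (* Puts the transverse coefficient in the form [4 * B] with [B = phi'(2F)/(2F)], as in the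
     second-variation estimate. *)
  replace (2 * dphi phi (2 * F) / F) with (4 * (dphi phi (2 * F) / (2 * F)))
    in Coer, Hc by (field; lra).
  rewrite psum_plus, !Lin in Coer.
  rewrite !psum_plus in Ha, Hc.
  set (e := l2norm N (bdiff N u)) in *.
  set (n1 := l2norm N (bdiff_n N 1 ua)) in *.
  set (n2 := l2norm N (bdiff_n N 2 ua)) in *.
  set (n3 := l2norm N (bdiff_n N 3 ua)) in *.
  assert (En : 0 <= e) by apply l2norm_nonneg.
  assert (En1 : 0 <= n1) by apply l2norm_nonneg.
  assert (En2 : 0 <= n2) by apply l2norm_nonneg.
  assert (En3 : 0 <= n3) by apply l2norm_nonneg.
  apply Rabs_le_between in FV; apply Rabs_le_between in SV.
  assert (P2 : 0 <= eps N ^ 2) by apply pow2_ge_0.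
  set (dAB := Rabs (ddphi phi (2 * F) - dphi phi (2 * F) / (2 * F))) in *.
  assert (HdAB : 0 <= dAB) by apply Rabs_pos.
  set (m := Rmax (Rabs (ddphi phi (2 * F))) (Rabs (dphi phi (2 * F) / (2 * F)))) in *.
  set (K1 := (4 * Cphi * F + 2 * PI ^ 2 * Rabs (dphi phi (2 * F))) * eps N ^ 2) in *.
  set (K2 := 4 * (Cphi * eps N ^ 2) * n1
      + (4 * PI ^ 2 * dAB * n1 + 2 * PI * dAB * n2 + m * n3) * eps N ^ 2) in *.
  (* Subtracting [Ha] from [Hc] cancels the load [ip N f u] and expresses the form of [Coer] through
     the two differences bounded in [FV] and [SV]. *)
  assert (Main : gamma2 phi F * e ^ 2 <= (K1 + K2) * e) by lra.
  assert (HK1 : K1 <= Ckappa phi F Cphi N * eps N ^ 2).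
  { apply Rmult_le_compat_r; [exact P2|]; unfold Ckappa.
    assert (0 <= Cphi * (PI ^ 2 * eps N ^ 2) * F).
    { apply Rmult_le_pos; [|lra].
      apply Rmult_le_pos; [lra|]; apply Rmult_le_pos; apply pow2_ge_0. }
    lra. }
  assert (HC1 : m <= C1 phi F Cphi /\ 4 * PI ^ 2 * dAB + 12 * Cphi <= C1 phi F Cphi).
  { unfold C1; fold dAB; split.
    - apply Rle_max_compat_l, Rmax_l.
    - eapply Rle_trans; [|apply Rmax_r]; apply Rmax_r. }
  destruct HC1 as [HC1 HC1'].
  (* Lets the same entry of the maximum [C1] cover the coefficient of [u''] as well as that of
     [u']. *)
  assert (HPI2 : 2 * PI * dAB <= 4 * PI ^ 2 * dAB)
    by (apply Rmult_le_compat_r; [exact HdAB | nra]).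
  assert (HK2 : K2 <= (C1 phi F Cphi * eps N ^ 2 + C2 Cphi * eps N ^ 4) * (n3 + n2 + n1)).
  { apply Rle_trans with (C1 phi F Cphi * eps N ^ 2 * (n3 + n2 + n1)).
    - assert (I1 : (4 * PI ^ 2 * dAB + 4 * Cphi) * n1 <= C1 phi F Cphi * n1)
        by (apply Rmult_le_compat_r; lra).
      assert (I2 : 2 * PI * dAB * n2 <= C1 phi F Cphi * n2)
        by (apply Rmult_le_compat_r; lra).
      assert (I3 : m * n3 <= C1 phi F Cphi * n3) by (apply Rmult_le_compat_r; lra).
      assert (I : (4 * PI ^ 2 * dAB + 4 * Cphi) * n1 + 2 * PI * dAB * n2 + m * n3
                  <= C1 phi F Cphi * (n3 + n2 + n1)) by lra.
      apply Rmult_le_compat_r with (r := eps N ^ 2) in I; [|exact P2].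
      unfold K2; lra.
    - apply Rmult_le_compat_r; [lra|].
      assert (0 <= C2 Cphi * eps N ^ 4); [|lra].
      apply Rmult_le_pos; [|apply pow_le; lra].
      unfold C2; apply Rmult_le_pos; lra. }
  assert (HeK : gamma2 phi F * e <= K1 + K2).
  (* One factor [e] is cancelled; for [e = 0] the claim is the nonnegativity of [K1 + K2]. *)
  { destruct (Rle_lt_or_eq_dec 0 e En) as [Hpos | <-].
    - apply Rmult_le_reg_r with e; [exact Hpos|]; lra.
    - rewrite Rmult_0_r.
      assert (0 <= m) by (apply Rle_trans with (2 := Rmax_l _ _); apply Rabs_pos).
      assert (0 <= PI ^ 2) by apply pow2_ge_0.
      apply Rplus_le_le_0_compat; unfold K1, K2;
        repeat first [ assumption | apply Rabs_pos | apply Rplus_le_le_0_compat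
                     | lra | apply Rmult_le_pos ]. }
  apply Rmult_le_reg_l with (gamma2 phi F); [exact Hg|].
  rewrite <- Rmult_assoc, Rinv_r, Rmult_1_l by lra.
  lra.
Qed.
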